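(* Let $(W,\mathrm{d})$ be a closed Hilbert complex with domain complex $(V,\mathrm{d})$, fix a degree $k$, and let $F\colon V^k\to W^k$ be monotone and Lipschitz continuous with respect to the $V$-norm. Then for every $f\in W^k$ there is a unique $(\sigma,u,p)\in V^{k-1}\times V^k\times\mathfrak{H}^k$ satisfying the mixed semilinear problem $$\begin{aligned}\langle\sigma,\tau\rangle-\langle u,\mathrm{d}\tau\rangle&=0&&\forall\tau\in V^{k-1},\\ \langle\mathrm{d}\sigma,v\rangle+\langle\mathrm{d}u,\mathrm{d}v\rangle+\langle p,v\rangle+\langle F(u+p),v\rangle&=\langle f,v\rangle&&\forall v\in V^k,\\ \langle u,q\rangle&=0&&\forall q\in\mathfrak{H}^k.\end{aligned}$$ Moreover, the problem is well-posed: given $f,f'\in W^k$, the respective solutions $(\sigma,u,p)$ and $(\sigma',u',p')$ satisfy $$\|\sigma-\sigma'\|_V+\|u-u'\|_V+\|p-p'\|\le C\|f-f'\|,$$ where the constant $C$ depends only on the Poincaré constant $c_P$ and on the Lipschitz constant of $F$.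
   Context: All Hilbert spaces are real. A Hilbert complex $(W,\mathrm{d})$ is a sequence of Hilbert spaces $W^k$ with closed, densely defined linear maps $\mathrm{d}^k\colon V^k\subset W^k\to V^{k+1}\subset W^{k+1}$ (possibly unbounded) such that $\mathrm{d}^k\circ\mathrm{d}^{k-1}=0$. It is closed if each image $\mathrm{d}^kV^k$ is closed in $W^{k+1}$. The inner product and norm of $W^k$ are written $\langle\cdot,\cdot\rangle$, $\|\cdot\|$. The domain complex $(V,\mathrm{d})$ consists of the domains $V^k$ with the graph inner product $\langle u,v\rangle_V=\langle u,v\rangle+\langle\mathrm{d}^ku,\mathrm{d}^kv\rangle$ and norm $\|\cdot\|_V$. Degree indices on $\mathrm{d}$ are suppressed. Put $\mathfrak{Z}^k=\ker\mathrm{d}^k$, $\mathfrak{B}^k=\mathrm{d}^{k-1}V^{k-1}$, $\mathfrak{H}^k=\mathfrak{Z}^k\cap\mathfrak{B}^{k\perp}$ (harmonic space). Since the complex is closed, there is a constant $c_P$ (Poincaré constant) such that $\|v\|_V\le c_P\|\mathrm{d}^jv\|$ for all $v\in V^j$ orthogonal to $\mathfrak{Z}^j$, for the relevant degrees $j=k-1,k$. $F\colon V^k\to W^k$ is monotone if $\langle Fu-Fv,u-v\rangle\ge0$ for all $u,v\in V^k$. It is Lipschitz continuous with respect to the $V$-norm if there is a constant $C_F$ (Lipschitz constant) with $\|Fu-Fv\|\le C_F\|u-v\|_V$ for all $u,v\in V^k$. *)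

(* Defs.v *)
From HB Require Import structures.
From mathcomp Require Import all_boot all_order all_algebra.
From mathcomp Require Import all_classical all_reals all_analysis.

Set Implicit Arguments.
Unset Strict Implicit.
Unset Printing Implicit Defensive.

Import Order.TTheory GRing.Theory Num.Theory.
Import numFieldNormedType.Exports.

Local Open Scope classical_set_scope.
Local Open Scope ring_scope.

HB.mixin Record CompleteNormedModule_isHilbert (R : realType) W
    of CompleteNormedModule R W := {
  inner : {dot W for idfun};
  sqr_norm_inner : forall x : W, `|x| ^+ 2 = inner x x
}.

#[short(type="hilbertType")]
HB.structure Definition Hilbert (R : realType) :=
  { W of CompleteNormedModule_isHilbert R W & CompleteNormedModule R W }.

Notation "''<' u , v >" := (inner u v)
  (at level 2, u at level 69, v at level 69, format "''<' u ,  v >") : ring_scope.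

Definition orthogonal_to (R : realType) (W : hilbertType R) (A : set W) : set W :=
  [set x | forall y, A y -> '<x, y> = 0].

(* Degrees range over all integers; complexes indexed by a segment of the
   integers are obtained by padding with zero spaces.
   [hc_d] is the partial map with domain [hc_dom]: it is a total function whose
   values outside [hc_dom] are unconstrained and never used. Its source and
   target degrees are linked by an equation, which is unique as a proof, so that
   both d^k : W k -> W (k + 1) and d^(k-1) : W (k - 1) -> W k are instances. *)
Record hilbertComplex (R : realType) := HilbertComplex {
  hc_space :> int -> hilbertType R;
  hc_dom : forall k, set (hc_space k);
  hc_d : forall i j : int, i + 1 = j -> hc_space i -> hc_space j;
  hc_dom0 : forall i, @hc_dom i 0;
  hc_domP : forall i (a : R) (x y : hc_space i),
    @hc_dom i x -> @hc_dom i y -> @hc_dom i (a *: x + y);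
  hc_dP : forall i j (ij : i + 1 = j) (a : R) (x y : hc_space i),
    @hc_dom i x -> @hc_dom i y ->
    hc_d ij (a *: x + y) = a *: hc_d ij x + hc_d ij y;
  hc_dom_dense : forall i, dense (@hc_dom i);
  hc_d_closed : forall i j (ij : i + 1 = j),
    closed [set xy : hc_space i * hc_space j |
             @hc_dom i xy.1 /\ xy.2 = hc_d ij xy.1];
  hc_d_dom : forall i j (ij : i + 1 = j) (x : hc_space i),
    @hc_dom i x -> @hc_dom j (hc_d ij x);
  hc_dd : forall i j l (ij : i + 1 = j) (jl : j + 1 = l) (x : hc_space i),
    @hc_dom i x -> hc_d jl (hc_d ij x) = 0
}.

Arguments hc_dom {R} h k _.

Section HilbertComplexDefs.
Context {R : realType} (W : hilbertComplex R).

Definition closed_complex : Prop :=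
  forall i j (ij : i + 1 = j), closed (hc_d ij @` hc_dom W i).

Definition d (k : int) : W k -> W (k + 1) := hc_d (erefl (k + 1)).

Definition dprev (k : int) : W (k - 1) -> W k := hc_d (subrK 1 k).

Definition innerV (k : int) (u v : W k) : R := '<u, v> + '<d u, d v>.

Definition normV (k : int) (u : W k) : R := Num.sqrt (innerV u u).

Definition cocycles (k : int) : set (W k) :=
  [set z | hc_dom W k z /\ d z = 0].

Definition coboundaries (k : int) : set (W k) :=
  @dprev k @` hc_dom W (k - 1).

Definition harmonic (k : int) : set (W k) :=
  @cocycles k `&` orthogonal_to (@coboundaries k).

Definition poincare_constant (j : int) (cP : R) : Prop :=
  forall v : W j, hc_dom W j v -> orthogonal_to (@cocycles j) v ->
    normV v <= cP * `|d v|.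

(* Only the values of F on the domain V^k matter in what follows. *)
Definition monotone_op (k : int) (F : W k -> W k) : Prop :=
  forall u v, hc_dom W k u -> hc_dom W k v -> 0 <= '<F u - F v, u - v>.

Definition lipschitz_constant (k : int) (F : W k -> W k) (CF : R) : Prop :=
  forall u v, hc_dom W k u -> hc_dom W k v ->
    `|F u - F v| <= CF * normV (u - v).

Definition mixed_solution (k : int) (F : W k -> W k) (f : W k)
    (sigma : W (k - 1)) (u p : W k) : Prop :=
  [/\ [/\ hc_dom W (k - 1) sigma, hc_dom W k u & harmonic p],
      forall tau, hc_dom W (k - 1) tau -> '<sigma, tau> - '<u, dprev tau> = 0,
      forall v, hc_dom W k v ->
        '<dprev sigma, v> + '<d u, d v> + '<p, v> + '<F (u + p), v> = '<f, v>
    & forall q, harmonic q -> '<u, q> = 0].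

End HilbertComplexDefs.

(* Main.v *)
(* Let S_j be the Moore-Penrose inverse of d^j; it is bounded because its graph
   is closed. With P the projection onto the harmonic space, a triple
   (sigma, u, p) solves the mixed problem once
     sigma = S_(k-1) g,  p = P g,  xi = S_k^* g,  u = S_(k-1)^* sigma + S_k xi,
   where g = f - F (u + p). With T = (S_(k-1)^*, P, S_k) and x = (sigma, p, xi)
   this is the Hammerstein equation x + T^* (F (T x)) = T^* f, and
   x |-> x + T^* (F (T x)) is strongly monotone and Lipschitz on
   W^(k-1) x W^k x W^(k+1), so that Banach's theorem applies.
   Stability follows by testing the difference of two problems with u + p, which
   by monotonicity bounds sigma, d u and p; the Poincare inequality then bounds u,
   and testing with d sigma bounds d sigma. *)
Require Import Defs.
From HB Require Import structures.
From mathcomp Require Import all_boot all_order all_algebra.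
From mathcomp Require Import all_classical all_reals all_analysis.
From mathcomp Require Import ring lra.
Import Order.TTheory GRing.Theory Num.Theory.
Import numFieldNormedType.Exports.
Local Open Scope classical_set_scope.
Local Open Scope ring_scope.

Set Implicit Arguments.
Unset Strict Implicit.
Unset Printing Implicit Defensive.

(** * Inner products *)

Section Inner.
Context {R : realType} {W : hilbertType R}.
Implicit Types (x y z : W) (a : R).

Lemma innerC x y : '<x, y> = '<y, x>.
Proof. by rewrite hermC /= expr0 mul1r. Qed.

Lemma innerDl x y z : '<x + y, z> = '<x, z> + '<y, z>.
Proof. exact: linearDl. Qed.

Lemma innerDr x y z : '<z, x + y> = '<z, x> + '<z, y>.
Proof. by rewrite innerC innerDl !(innerC z). Qed.

Lemma innerZl a x z : '<a *: x, z> = a * '<x, z>.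
Proof. exact: linearZl_LR. Qed.

Lemma innerZr a x z : '<z, a *: x> = a * '<z, x>.
Proof. by rewrite innerC innerZl innerC. Qed.

Lemma innerNl x z : '<- x, z> = - '<x, z>.
Proof. exact: linearNl. Qed.

Lemma innerNr x z : '<z, - x> = - '<z, x>.
Proof. by rewrite innerC innerNl innerC. Qed.

Lemma inner0l z : '<0, z> = 0.
Proof. exact: linear0l. Qed.

Lemma inner0r z : '<z, 0> = 0.
Proof. by rewrite innerC inner0l. Qed.

Definition innerE := (innerDl, innerDr, innerNl, innerNr, innerZl, innerZr).

Lemma inner_eq0 x : '<x, x> = 0 -> x = 0.
Proof. by rewrite -sqr_norm_inner => /eqP; rewrite sqrf_eq0 normr_eq0 => /eqP. Qed.

Lemma sqr_normD x y : `|x + y| ^+ 2 = `|x| ^+ 2 + 2 * '<x, y> + `|y| ^+ 2.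
Proof. by rewrite !sqr_norm_inner !innerE (innerC y x); ring. Qed.

(** Stated with the midpoint: in a midpoint-convex set its norm is at least the infimum, which makes
    minimising sequences Cauchy. *)
Lemma parallelogram x y :
  `|x - y| ^+ 2 = 2 * `|x| ^+ 2 + 2 * `|y| ^+ 2 - 4 * `|2^-1 *: (x + y)| ^+ 2.
Proof. by rewrite !sqr_norm_inner !innerE (innerC y x); field. Qed.

Lemma inner_le x y : '<x, y> <= `|x| * `|y|.
Proof.
have [->|x0] := eqVneq x 0; first by rewrite inner0l normr0 mul0r.
have [->|y0] := eqVneq y 0; first by rewrite inner0r normr0 mulr0.
have nx : 0 < `|x| by rewrite normr_gt0.
have ny : 0 < `|y| by rewrite normr_gt0.
(* This square expands to 2 |x| |y| (|x| |y| - <x, y>). *)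
have : 0 <= `|(`|y| *: x) + (- `|x|) *: y| ^+ 2 by exact: exprn_ge0.
rewrite sqr_normD !normrZ !normrN !normr_id !innerE => h.
have : 0 <= (`|x| * `|y|) * (`|x| * `|y| - '<x, y>) by lra.
by rewrite pmulr_rge0 ?mulr_gt0// subr_ge0.
Qed.

Lemma norm_inner_le x y : `|'<x, y>| <= `|x| * `|y|.
Proof.
by rewrite ler_norml inner_le andbT lerNl -innerNl -(normrN x) inner_le.
Qed.

Lemma inner_continuous z : continuous (fun x : W => '<x, z>).
Proof.
move=> x; apply/cvgrPdist_le => /= e e0; near=> y.
rewrite -innerNl -innerDl; apply: le_trans (norm_inner_le _ _) _.
have h : `|x - y| <= e / (`|z| + 1).
  near: y; apply: cvgr_dist_le => //; rewrite divr_gt0// ltr_wpDl//.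
apply: (@le_trans _ _ (e / (`|z| + 1) * (`|z| + 1))).
  by apply: ler_pM => //; rewrite lerDl.
by rewrite divfK// gt_eqF// ltr_wpDl.
Unshelve. all: by end_near. Qed.

Lemma closed_orthogonal (A : set W) : closed (orthogonal_to A).
Proof.
have -> : orthogonal_to A = \bigcap_(y in A) [set x | '<x, y> = 0].
  by apply/seteqP; split => x h y /h.
apply: closed_bigI => y _.
apply: (preimage_closed _ (@closed_eq _ 0)) => x _.
exact: inner_continuous.
Qed.

End Inner.

(** * Projections *)

Lemma closed_seq_cvg {T : topologicalType} (A : set T) (u : nat -> T) (l : T) :
  closed A -> (forall n, A (u n)) -> u @ \oo --> l -> A l.
Proof. by move=> clA Au; apply: closed_cvg => //; exact: nearW. Qed.

Lemma cauchy_seq_cvg {R : realType} {W : completeNormedModType R}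
    (u : nat -> W) (e : nat -> R) :
  (forall n k, (n <= k)%N -> `|u n - u k| ^+ 2 <= e n) ->
  e @ \oo --> 0 -> cvgn u.
Proof.
move=> ue e0; apply: cauchy_cvg; apply: cauchy_exP => eps eps0.
have eps2 : 0 < eps ^+ 2 by exact: exprn_gt0.
have /cvgrPdist_lt/(_ _ eps2)[N _ Ne] := e0.
exists (u N); exists N => // k /= Nk.
rewrite -ball_normE /=.
rewrite -(ltr_pXn2r (n := 2))// ?nnegrE// ?ltW//.
apply: le_lt_trans (ue _ _ Nk) _; have /= := Ne N (leqnn N).
by rewrite sub0r normrN; apply: le_lt_trans; exact: ler_norm.
Qed.

(** Each [a n] has nearly least norm in [A n]. The infima of the squared norms increase and are
    bounded, so the parallelogram law makes [a] Cauchy. Constant [A] gives projections; images of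
    shrinking balls give the closed graph theorem. *)
Lemma nested_midconvex_cvg {R : realType} {W : hilbertType R}
    (A : nat -> set W) (M0 : R) :
  (forall n k, (n <= k)%N -> A k `<=` A n) ->
  (forall n x y, A n x -> A n y -> A n (2^-1 *: (x + y))) ->
  (forall n, exists2 x, A n x & `|x| <= M0) ->
  exists a l, [/\ forall n, A n (a n), a @ \oo --> l &
    forall M, (forall n, exists2 x, A n x & `|x| <= M) -> `|l| <= M].
Proof.
move=> decrA midA bndA.
pose E n := [set `|x| ^+ 2 | x in A n].
have lbE n : has_lbound (E n) by exists 0 => _ [x _ <-]; exact: exprn_ge0.
have infE n x : A n x -> inf (E n) <= `|x| ^+ 2.
  by move=> Ax; apply: ge_inf => //; exists x.
have infE_le M n : (forall n, exists2 x, A n x & `|x| <= M) ->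
    inf (E n) <= M ^+ 2.
  move=> /(_ n)[x Ax xM]; apply: le_trans (infE _ _ Ax) _.
  by rewrite lerXn2r// ?nnegrE// (le_trans _ xM).
have nondecE : {homo (fun n => inf (E n)) : n k / (n <= k)%N >-> n <= k}.
  move=> n k nk; apply: lb_le_inf.
    by have [x Ax _] := bndA k; exists (`|x| ^+ 2); exists x.
  by move=> _ [x Ax <-]; apply: infE; exact: decrA Ax.
have cvgE : cvgn (fun n => inf (E n)).
  by apply: nondecreasing_is_cvgn => //; exists (M0 ^+ 2) => _ [n _ <-]; exact: infE_le.
have leE n : inf (E n) <= limn (fun n => inf (E n)).
  exact: nondecreasing_cvgn_le.
have /choice[a aP] n : exists x, A n x /\ `|x| ^+ 2 < inf (E n) + n.+1%:R^-1.
  have n0 : 0 < n.+1%:R^-1 :> R by rewrite invr_gt0.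
  have hinf : has_inf (E n).
    by split => //; have [x Ax _] := bndA n; exists (`|x| ^+ 2); exists x.
  by have [_ [x Ax <-] xlt] := inf_adherent n0 hinf; exists x.
(* For n <= k the midpoint of [a n] and [a k] lies in [A n], so |a n - a k|^2 is at most 2 |a n|^2 +
   2 |a k|^2 - 4 inf (E n), which [e n] bounds. *)
pose e n := 2 * (limn (fun n => inf (E n)) - inf (E n)) + 4 * n.+1%:R^-1.
have /cvg_ex[l al] : cvgn a.
  apply: (@cauchy_seq_cvg _ _ _ e) => [n k nk|].
    rewrite parallelogram.
    have mid := infE n _ (midA _ _ _ (aP n).1 (decrA _ _ nk _ (aP k).1)).
    have kn : k.+1%:R^-1 <= n.+1%:R^-1 :> R by rewrite lef_pV2 ?posrE// ler_nat.
    have := (aP n).2; have := (aP k).2; have := leE k; rewrite /e; move: kn mid.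
    move: (limn _) (inf _) (inf _) (n.+1%:R^-1) (k.+1%:R^-1).
    by move: (`|_| ^+ 2) (`|_| ^+ 2) (`|_| ^+ 2) => *; lra.
  have -> : 0 = 2 * (limn (fun n => inf (E n)) - limn (fun n => inf (E n))) + 4 * 0 :> R.
    by rewrite subrr !mulr0 addr0.
  apply: cvgD; apply: cvgMr; last exact: cvg_harmonic.
  by apply: cvgB => //; exact: cvg_cst.
exists a, l; split => // [n|M HM]; first exact: (aP n).1.
have M_ge0 : 0 <= M by have [x _] := HM 0%N; apply: le_trans.
rewrite -(ler_pXn2r (n := 2))// ?nnegrE//.
have cl : (fun n => `|a n| ^+ 2) @ \oo --> `|l| ^+ 2.
  by under eq_fun do rewrite expr2; rewrite expr2; apply: cvgM; exact: cvg_norm.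
have cM : (fun n => M ^+ 2 + n.+1%:R^-1) @ \oo --> M ^+ 2.
  rewrite -[X in _ --> X]addr0; apply: cvgD; [exact: cvg_cst|exact: cvg_harmonic].
apply: (ler_cvg_to cl cM); apply: nearW => n.
by apply: ltW; apply: lt_le_trans (aP n).2 _; rewrite lerD2r infE_le.
Qed.

Definition subspace_set {R : realType} {W : lmodType R} (M : set W) :=
  M 0 /\ forall a x y, M x -> M y -> M (a *: x + y).

Section Subspace.
Context {R : realType} {W : lmodType R} (M : set W) (subM : subspace_set M).

Lemma subspace_setD x y : M x -> M y -> M (x + y).
Proof. by move=> Mx My; rewrite -(scale1r x); exact: subM.2. Qed.

Lemma subspace_setZ a x : M x -> M (a *: x).
Proof. by move=> Mx; rewrite -(addr0 (a *: x)); apply: subM.2 => //; exact: subM.1. Qed.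

Lemma subspace_setN x : M x -> M (- x).
Proof. by move=> Mx; rewrite -scaleN1r; exact: subspace_setZ. Qed.

Lemma subspace_setB x y : M x -> M y -> M (x - y).
Proof. by move=> Mx /subspace_setN; exact: subspace_setD. Qed.

End Subspace.

(** First-order condition for a minimum at t = 0. If c > 0, the minimiser -b / 2c is tested;
    otherwise t = 1 and t = -1 suffice. *)
Lemma quadratic_ge0 {R : realType} (b c : R) :
  (forall t : R, 0 <= t * b + t ^+ 2 * c) -> b = 0.
Proof.
move=> h; have [c0|c0] := ltP 0 c.
  have := h (- b / (2 * c)).
  have -> : - b / (2 * c) * b + (- b / (2 * c)) ^+ 2 * c = - (b ^+ 2) / (4 * c).
    by field; rewrite gt_eqF.
  rewrite mulNr oppr_ge0 pmulr_lle0 ?invr_gt0 ?mulr_gt0// => b2.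
  by apply/eqP; rewrite -sqrf_eq0 eq_le b2 sqr_ge0.
by have := h 1; have := h (-1); rewrite expr1n sqrrN expr1n; lra.
Qed.

Definition mk_linear {R : pzRingType} {V W : lmodType R} (f : V -> W)
    (lf : linear f) : {linear V -> W} :=
  HB.pack f (GRing.isLinear.Build _ _ _ _ _ lf).

Section Projection.
Context {R : realType} {W : hilbertType R} (M : set W).
Hypotheses (subM : subspace_set M) (closedM : closed M).

(** The translate of [M] by x contains an element [l] of least norm, and p = x - l; comparing [l]
    with l + t y gives orthogonality. *)
Lemma projection_exists x : exists2 p, M p & forall y, M y -> '<x - p, y> = 0.
Proof.
have midA (n : nat) y z : [set x - y | y in M] y -> [set x - y | y in M] z ->
    [set x - y | y in M] (2^-1 *: (y + z)).
  move=> [{}y My <-] [{}z Mz <-]; exists (2^-1 *: (y + z)).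
    by apply: subspace_setZ => //; exact: subspace_setD.
  rewrite addrACA -opprD scalerBr (scalerDr _ x x) -scalerDl.
  by rewrite [X in X *: x](_ : _ = 1) ?scale1r//; lra.
have bndA (n : nat) : exists2 y, [set x - y | y in M] y & `|y| <= `|x|.
  by exists x => //; exists 0; [exact: subM.1|rewrite subr0].
have [a [l [aP al lmin]]] :=
  @nested_midconvex_cvg _ _ (fun=> [set x - y | y in M]) `|x|
    (fun _ _ _ _ => id) midA bndA.
have Ml : M (x - l).
  apply: (@closed_seq_cvg _ M (fun n => x - a n)) => // [n|].
    by have [y My <-] := aP n; rewrite opprB addrC subrK.
  by apply: cvgB => //; exact: cvg_cst.
exists (x - l) => // y My; rewrite opprB addrC subrK.
suff : 2 * '<l, y> = 0 by lra.
apply: (@quadratic_ge0 _ _ (`|y| ^+ 2)) => t.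
have le_l : `|l| <= `|l + t *: y|.
  apply: lmin => _; exists (l + t *: y) => //; exists (x - l - t *: y).
    by apply: subspace_setB => //; exact: subspace_setZ.
  by rewrite -addrA -opprD opprB addrC subrK.
have : `|l| ^+ 2 <= `|l + t *: y| ^+ 2 by rewrite lerXn2r// nnegrE.
by rewrite sqr_normD normrZ exprMn real_normK ?num_real// innerZr; lra.
Qed.

(** Linearity follows from uniqueness: the defect [q] lies in [M] and is orthogonal to [M]. *)
Lemma projection_linear : exists P : {linear W -> W},
  (forall x, M (P x)) /\ forall x y, M y -> '<x - P x, y> = 0.
Proof.
have /choice[P PP] x : exists p, M p /\ forall y, M y -> '<x - p, y> = 0.
  by have [p Mp pP] := projection_exists x; exists p.
suff linP : linear P.
  by exists (mk_linear linP); split => x; [exact: (PP x).1|exact: (PP x).2].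
move=> a x y.
apply/subr0_eq/inner_eq0.
set q := _ - _.
have Mq : M q by apply: subspace_setB => //; [exact: (PP _).1|apply: subM.2; exact: (PP _).1].
rewrite {1}/q.
have -> : P (a *: x + y) - (a *: P x + P y) =
  - (a *: x + y - P (a *: x + y)) + (a *: (x - P x) + (y - P y)).
  by rewrite scalerBr opprB [X in _ = _ + X]addrACA -opprD addrA subrK.
by rewrite innerDl innerNl (PP _).2// innerDl innerZl !(PP _).2// mulr0 !addr0 oppr0.
Qed.

End Projection.

(** * Closed graph theorem *)

Lemma lipschitz_linear_continuous {R : realType} {V W : normedModType R}
    (f : {linear V -> W}) (c : R) :
  (forall x, `|f x| <= c * `|x|) -> continuous f.
Proof.
move=> fc; apply: linear_continuous; apply/bounded_landau => r.
exists (`|c| * r) => x xr; apply: le_trans (fc x) _.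
apply: (@le_trans _ _ (`|c| * `|x|)); first by rewrite ler_wpM2r// ler_norm.
by rewrite ler_wpM2l.
Qed.

(** Cancels one norm factor in estimates obtained by pairing a vector with itself. *)
Lemma sqr_le_norm {R : realDomainType} {W : normedZmodType R} (x : W) (c : R) :
  0 <= c -> `|x| ^+ 2 <= c * `|x| -> `|x| <= c.
Proof.
move=> c0; have [->|x0] := eqVneq x 0; first by rewrite normr0.
by rewrite expr2 ler_pM2r ?normr_gt0.
Qed.

Lemma riesz_representation {R : realType} {W : hilbertType R}
    (phi : {linear W -> R^o}) (c : R) :
  (forall x, `|phi x| <= c * `|x|) -> exists s, forall x, phi x = '<x, s>.
Proof.
move=> phic; pose M := [set x | phi x = 0].
have subM : subspace_set M.
  split => [|a x y]; rewrite /M /=; first exact: linear0.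
  by move=> px py; rewrite linearP px py scaler0 addr0.
have closedM : closed M.
  apply: (preimage_closed (f := phi) _ (@closed_eq _ 0)) => x _.
  exact: lipschitz_linear_continuous phic _.
have [P [MP PP]] := projection_linear subM closedM.
have [|/existsNP[y /eqP phiy]] := pselect (forall x, phi x = 0).
  by move=> phi0; exists 0 => x; rewrite inner0r.
have : phi (y - P y) != 0 by rewrite linearB /= (MP y) subr0.
move: (y - P y) (PP y) => n nM phin.
have n0 : '<n, n> != 0.
  by apply: contra_neq phin => /inner_eq0 ->; rewrite linear0.
(* [n] is normal to the kernel of [phi]; the factor makes both sides agree at x = n. *)
exists ((phi n / '<n, n>) *: n) => x.
have Mx : M (x - (phi x / phi n) *: n).
  by rewrite /M /= linearB linearZ /= [_ *: _]mulrC mulrCA divff// mulr1 subrr.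
have := nM _ Mx; rewrite !innerE => /eqP.
rewrite subr_eq0 => /eqP; rewrite (innerC x) => ->.
by field; rewrite phin n0.
Qed.

Section ClosedGraph.
Context {R : realType} {H1 H2 : hilbertType R} (S : {linear H1 -> H2}).
Hypothesis closedS : closed [set xy : H1 * H2 | xy.2 = S xy.1].

(* Norm-minimising images of shrinking balls around y converge, by the
   parallelogram law, and the limit is S y: this replaces weak compactness. *)
Lemma closed_graph_sublevel (r : R) : closed [set y | `|S y| <= r].
Proof.
move=> y cly.
pose A (n : nat) := [set S x | x in [set x | `|x - y| <= n.+1%:R^-1]].
have decrA n k : (n <= k)%N -> A k `<=` A n.
  move=> nk _ [x /= xy <-]; exists x => //=; apply: le_trans xy _.
  by rewrite lef_pV2 ?posrE// ler_nat.
have midA n u v : A n u -> A n v -> A n (2^-1 *: (u + v)).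
  move=> [x /= xy <-] [z /= zy <-]; exists (2^-1 *: (x + z)) => /=; last first.
    by rewrite linearZ linearD.
  have -> : 2^-1 *: (x + z) - y = 2^-1 *: ((x - y) + (z - y)).
    rewrite addrACA -opprD scalerBr (scalerDr _ y y) -(scalerDl y).
    by rewrite [X in _ - X *: _](_ : _ = 1) ?scale1r//; lra.
  rewrite normrZ ger0_norm//; have := ler_normD (x - y) (z - y).
  by move: xy zy; move: `|x - y + (z - y)| `|x - y| `|z - y| n.+1%:R^-1 => *; lra.
have bndA n : exists2 u, A n u & `|u| <= r.
  have [|x [/= Sx yx]] := cly (ball y n.+1%:R^-1).
    by apply: nbhsx_ballx; rewrite invr_gt0.
  exists (S x) => //; exists x => //=; rewrite distrC; apply: ltW.
  by move: yx; rewrite -ball_normE.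
have [a [l [aP al lmin]]] := nested_midconvex_cvg decrA midA bndA.
have /choice[x xP] n : exists x, `|x - y| <= n.+1%:R^-1 /\ S x = a n.
  by have [x] := aP n; exists x.
have xy : x @ \oo --> y.
  apply/cvgrPdist_le => e e0; have := @cvg_harmonic R.
  move=> /cvgrPdist_le/(_ _ e0); apply: filterS => n /=.
  rewrite sub0r normrN gtr0_norm ?invr_gt0// distrC; apply: le_trans.
  exact: (xP n).1.
suff Sy : S y = l by rewrite /= Sy; exact: lmin.
apply/esym; apply: (@closed_seq_cvg _ _ (fun n => (x n, a n)) (y, l) closedS) => [n/=|].
  by rewrite (xP n).2.
exact: cvg_pair.
Qed.

Lemma closed_graph_bounded : exists2 c, 0 <= c & forall y, `|S y| <= c * `|y|.
Proof.
pose O n := [set y : H1 | n%:R < `|S y|].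
have openO n : open (O n).
  have -> : O n = ~` [set y : H1 | `|S y| <= n%:R].
    by apply/seteqP; rewrite /O; split => y /=; [rewrite ltNge => /negP|move=> /negP; rewrite -ltNge].
  exact/closed_openC/closed_graph_sublevel.
(* The open sets [O n] have empty intersection, so by Baire one of them is not dense and |S y| <= n
   holds on a ball. *)
have [n /denseNE[U [[y0 /open_nbhs_nbhs/nbhs_ballP[r /= r0 bU]] UO]]] :
    exists n, ~ dense (O n).
  apply: contrapT => /forallNP denseO.
  have /(_ setT) : dense (\bigcap_i O i).
    by apply: Baire => i; split => //; exact: contrapT (denseO i).
  case; [by exists 0|exact: openT|move=> y [_ /(_ (Num.truncn `|S y|).+1 Logic.I)]].
  by rewrite /O /= ltNge le_eqVlt truncnS_gt orbT.
have bnd h : `|h| < r -> `|S h| <= 2 * n%:R.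
  have inball z : ball y0 r z -> `|S z| <= n%:R.
    move=> yz; rewrite leNgt; apply/negP => Oz.
    by have : (U `&` O n) z; [split => //; exact: bU|rewrite UO].
  move=> hr; have -> : h = (y0 + h) - y0 by rewrite addrC addKr.
  rewrite linearB /=; apply: le_trans (ler_normB _ _) _.
  rewrite mulr_natl mulr2n; apply: lerD; apply: inball; last exact: ballxx.
  by rewrite -ball_normE /= opprD addNKr normrN.
(* Differences from the centre [y0] give the bound 2 n for |h| < r; rescaling y to norm r / 2 gives
   the factor 2 / r. *)
exists (2 * n%:R * (2 / r)); first by rewrite !mulr_ge0// invr_ge0 ltW.
move=> y; have [->|y0'] := eqVneq y 0; first by rewrite linear0 !normr0 mulr0.
have ny : 0 < `|y| by rewrite normr_gt0.
have t0 : 0 < r / 2 / `|y| by rewrite !divr_gt0.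
have := bnd ((r / 2 / `|y|) *: y).
rewrite linearZ /= (normrZ _ y) (normrZ _ (S y)) (gtr0_norm t0) divfK ?gt_eqF// => /(_ _).
rewrite ltr_pdivrMr// ltr_pMr// ltr1n => /(_ isT).
rewrite mulrC -ler_pdivlMr// => /le_trans; apply.
by rewrite !invfM !invrK [2 * r^-1]mulrC !mulrA.
Qed.

End ClosedGraph.

(** * Pseudo-inverses of operators with closed range *)

Lemma inner_inj {R : realType} {W : hilbertType R} (x y : W) :
  (forall z, '<z, x> = '<z, y>) -> x = y.
Proof.
move=> xy; apply/subr0_eq/inner_eq0.
by rewrite innerDr innerNr xy subrr.
Qed.

(** Riesz representation of y |-> <S y, x> gives S' x, and |S' x|^2 = <S (S' x), x> gives the same
    bound [c]. *)
Lemma adjoint_exists {R : realType} {H1 H2 : hilbertType R}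
    (S : {linear H1 -> H2}) (c : R) : 0 <= c ->
  (forall y, `|S y| <= c * `|y|) ->
  exists S' : {linear H2 -> H1},
    (forall x, `|S' x| <= c * `|x|) /\ forall y x, '<S y, x> = '<y, S' x>.
Proof.
move=> c0 Sc.
have /choice[T TP] x : exists s, forall y, '<S y, x> = '<y, s>.
  have lin : linear (fun y => '<S y, x> : R^o).
    by move=> a u v; rewrite linearP innerDl innerZl.
  apply: (@riesz_representation _ _ (mk_linear lin) (c * `|x|)) => y /=.
  apply: le_trans (norm_inner_le _ _) _; rewrite mulrAC.
  by rewrite ler_wpM2r.
have linT : linear T.
  move=> a u v; apply: inner_inj => z.
  by rewrite -TP !innerDr !innerZr !TP.
exists (mk_linear linT); split => //= x.
apply: sqr_le_norm; first exact: mulr_ge0.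
rewrite sqr_norm_inner -TP; apply: le_trans (inner_le _ _) _.
by rewrite mulrAC ler_wpM2r.
Qed.

Section OrthogonalProjection.
Context {R : realType} {W : hilbertType R} (M : set W) (P : {linear W -> W}).
Hypotheses (MP : forall x, M (P x)) (PP : forall x y, M y -> '<x - P x, y> = 0).

Lemma projection_inner x y : '<P x, y> = '<x, P y>.
Proof.
have := PP x (MP y); have := PP y (MP x).
by rewrite !innerDl !innerNl (innerC y) (innerC (P y)); lra.
Qed.

Lemma projection_id x : M x -> P x = x.
Proof.
move=> Mx; apply/esym/subr0_eq/inner_eq0.
by rewrite innerDr innerNr (PP x Mx) (PP x (MP x)) subrr.
Qed.

Lemma projection_le x : `|P x| <= `|x|.
Proof.
apply: sqr_le_norm => //; rewrite sqr_norm_inner.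
have := PP x (MP x); rewrite innerDl innerNl => /eqP; rewrite subr_eq0 => /eqP <-.
exact: inner_le.
Qed.

End OrthogonalProjection.

Section ClosedRangeOperator.
Context {R : realType} {H1 H2 : hilbertType R} (D : set H1) (A : H1 -> H2).
Hypotheses (subD : subspace_set D)
  (linA : forall a x y, D x -> D y -> A (a *: x + y) = a *: A x + A y)
  (closedA : closed [set xy : H1 * H2 | D xy.1 /\ xy.2 = A xy.1])
  (closedB : closed (A @` D)).

Let Z : set H1 := [set x | D x /\ A x = 0].

Lemma operator0 : A 0 = 0.
Proof.
have := linA 1 subD.1 subD.1; rewrite !scale1r addr0 => /eqP.
by rewrite -subr_eq0 opprD addrA subrr sub0r oppr_eq0 => /eqP.
Qed.

Lemma operatorB x y : D x -> D y -> A (x - y) = A x - A y.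
Proof.
move=> Dx Dy; rewrite addrC -scaleN1r linA// scaleN1r addrC//.
Qed.

Lemma subspace_range : subspace_set (A @` D).
Proof.
split; first by exists 0; [exact: subD.1|exact: operator0].
move=> a _ _ [x Dx <-] [y Dy <-].
by exists (a *: x + y); [exact: subD.2|exact: linA].
Qed.

Lemma subspace_kernel : subspace_set Z.
Proof.
split; first by split; [exact: subD.1|exact: operator0].
move=> a x y [Dx Ax] [Dy Ay]; split; first exact: subD.2.
by rewrite linA// Ax Ay scaler0 addr0.
Qed.

Lemma closed_kernel : closed Z.
Proof.
have -> : Z = (fun x => (x, 0 : H2)) @^-1`
    [set xy : H1 * H2 | D xy.1 /\ xy.2 = A xy.1].
  by apply/seteqP; split => x [Dx Ax].
apply: preimage_closed closedA => x _.
by apply: cvg_pair; [exact: cvg_id|exact: cvg_cst].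
Qed.

(* S is the Moore-Penrose inverse: A \o S is the orthogonal projection onto the
   range of A, and S takes its values in the orthogonal complement of the kernel. *)
Definition pseudo_inverse (S : H2 -> H1) :=
  [/\ forall y, D (S y), forall y, orthogonal_to Z (S y) &
      forall y v, D v -> '<A (S y) - y, A v> = 0].

(** Both A x and A x' are the projection of y onto the range, so x - x' lies in the kernel and is
    orthogonal to it. Linearity and closedness of the graph of the pseudo-inverse rest on this. *)
Lemma pseudo_inverse_unique x x' (y : H2) :
  D x -> orthogonal_to Z x -> (forall v, D v -> '<A x - y, A v> = 0) ->
  D x' -> orthogonal_to Z x' -> (forall v, D v -> '<A x' - y, A v> = 0) ->
  x = x'.
Proof.
move=> Dx Zx Ax Dx' Zx' Ax'.
have Dxx' : D (x - x') by exact: subspace_setB.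
have Zxx' : Z (x - x').
  split => //; apply: inner_eq0; rewrite {1}operatorB//.
  have -> : A x - A x' = (A x - y) - (A x' - y) by rewrite opprB addrA subrK.
  by rewrite innerDl innerNl Ax// Ax'// subrr.
by apply/subr0_eq/inner_eq0; rewrite {1}innerDl innerNl Zx// Zx'// subrr.
Qed.

Lemma pseudo_inverse_exists : exists (S : {linear H2 -> H1}) (c : R),
  [/\ 0 <= c, forall y, `|S y| <= c * `|y| & pseudo_inverse S].
Proof.
have [P [BP PP]] := projection_linear subspace_range closedB.
have [Q [ZQ QQ]] := projection_linear subspace_kernel closed_kernel.
have /choice[S SP] y : exists x,
    [/\ D x, orthogonal_to Z x & A x = P y].
  (* A preimage of P y, stripped of its kernel component. *)
  have [v Dv Av] := BP y; exists (v - Q v).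
  have [DQ AQ] := ZQ v; split; first exact: subspace_setB.
    by move=> z Zz; exact: QQ.
  by rewrite operatorB// AQ subr0.
have pinvS : pseudo_inverse S.
  split => [y|y|y v Dv]; [by have [] := SP y|by have [] := SP y|].
  have [_ _ ->] := SP y; rewrite -opprB innerNl PP ?oppr0//; exact: imageP.
have [SD SZ SA] := pinvS.
have linS : linear S.
  move=> a y z; apply: (pseudo_inverse_unique (y := a *: y + z)) => //.
  - by move=> v Dv; exact: SA.
  - exact: subD.2.
  - by move=> x Zx; rewrite innerDl innerZl !SZ// mulr0 addr0.
  - move=> v Dv; rewrite linA// opprD addrACA -scalerBr.
    by rewrite innerDl innerZl !SA// mulr0 addr0.
suff cS : closed [set yx : H2 * H1 | yx.2 = mk_linear linS yx.1].
  by have [c c0 Sc] := closed_graph_bounded cS; exists (mk_linear linS), c.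
(* The graph of [S] is cut out by A x = P y and x orthogonal to the kernel, both closed conditions
   since [A] is closed and [P] continuous. *)
have -> : [set yx : H2 * H1 | yx.2 = mk_linear linS yx.1] =
  ((fun yx : H2 * H1 => (yx.2, P yx.1)) @^-1`
    [set xy : H1 * H2 | D xy.1 /\ xy.2 = A xy.1]) `&`
  (snd @^-1` orthogonal_to Z).
  apply/seteqP; split => -[y x] /=.
    move=> ->; split => //; split; first exact: SD.
    by have [_ _ ->] := SP y.
  move=> [[Dx Ax] Zx]; apply: (pseudo_inverse_unique (y := y)) => // v Dv.
    rewrite -Ax -opprB innerNl PP ?oppr0//; exact: imageP.
  exact: SA.
have contP : continuous P.
  apply: (@lipschitz_linear_continuous _ _ _ P 1) => z.
  by rewrite mul1r; exact: projection_le BP PP z.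
apply: closedI.
  apply: preimage_closed closedA => -[y x] _; apply: cvg_pair; first exact: cvg_snd.
  exact: (cvg_comp fst P cvg_fst (contP y)).
apply: (@preimage_closed _ _ snd _ _ (@closed_orthogonal _ _ Z)).
by move=> -[y x] _; exact: cvg_snd.
Qed.

Section PseudoInverse.
Variables (S : {linear H2 -> H1}) (S' : {linear H1 -> H2}).
Hypotheses (pinvS : pseudo_inverse S) (adjS : forall y x, '<S y, x> = '<y, S' x>).

(** The defining orthogonality of S (A v) is tested with v - S (A v) itself. *)
Lemma pseudo_inverse_kernel v : D v -> Z (v - S (A v)).
Proof.
move=> Dv; have [SD SZ SA] := pinvS.
split; first exact: subspace_setB.
apply: inner_eq0; rewrite {1}operatorB// -opprB innerNl.
by rewrite SA ?oppr0//; exact: subspace_setB.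
Qed.

Lemma pseudo_inverse_orthogonal y : orthogonal_to (A @` D) y -> S y = 0.
Proof.
move=> By; have [SD SZ SA] := pinvS.
apply: inner_eq0; apply: SZ; split => //; apply: inner_eq0.
have := SA y _ (SD y); rewrite innerDl innerNl By ?subr0//.
exact: imageP.
Qed.

(** [S] vanishes on the orthogonal complement of the closed range of [A], so S' x has no component
    there. This makes the part of u coming from sigma a coboundary. *)
Lemma adjoint_pseudo_inverse_range x : (A @` D) (S' x).
Proof.
have [P [BP PP]] := projection_linear subspace_range closedB.
suff -> : S' x = P (S' x) by exact: BP.
apply/subr0_eq/inner_eq0.
rewrite innerDr innerNr (PP _ _ (BP _)) subr0 -adjS pseudo_inverse_orthogonal ?inner0l//.
by move=> y By; exact: PP.
Qed.

End PseudoInverse.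

End ClosedRangeOperator.

(** * Hammerstein equations *)

Section ProdComplete.
Context {R : realType} (A B : completeNormedModType R).

(* Makes the join of the pointed and uniform structures available on products. *)
HB.instance Definition _ := Pointed.on (A * B)%type.

Lemma prod_cauchy_cvg (F : set_system (A * B)) :
  ProperFilter F -> cauchy F -> cvg F.
Proof.
move=> FF cF.
have F_ent E1 E2 : entourage E1 -> entourage E2 ->
    exists2 U, F U & forall x y, U x -> U y -> E1 (x.1, y.1) /\ E2 (x.2, y.2).
  move=> entE1 entE2; have [[X Y] [/= FX FY] XY] := cF _ (prod_entP entE1 entE2).
  exists (X `&` Y); first exact: filterI.
  by move=> x y [Xx _] [_ Yy]; exact: (XY (x, y)).
have /cvg_ex[l1 cv1] : cvg (fst @ F).
  apply: cauchy_cvg => E entE.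
  have [U FU UE] := F_ent _ setT entE filterT.
  have FU' : F (fst @^-1` (fst @` U)) by apply: filterS FU => x Ux; exists x.
  exists (fst @` U, fst @` U) => // -[_ _] /= [[x Ux <-] [y Uy <-]].
  exact: (UE x y Ux Uy).1.
have /cvg_ex[l2 cv2] : cvg (snd @ F).
  apply: cauchy_cvg => E entE.
  have [U FU UE] := F_ent setT _ filterT entE.
  have FU' : F (snd @^-1` (snd @` U)) by apply: filterS FU => x Ux; exists x.
  exists (snd @` U, snd @` U) => // -[_ _] /= [[x Ux <-] [y Uy <-]].
  exact: (UE x y Ux Uy).2.
apply/cvg_ex; exists (l1, l2).
move=> U /(cvg_pair cv1 cv2) FU; apply: (@filterS _ F _ _ _ _ FU); by case.
Qed.

HB.instance Definition _ :=
  Uniform_isComplete.Build (A * B)%type prod_cauchy_cvg.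

End ProdComplete.


(** * Contractions for an equivalent norm *)

Section FixedPoint.
Context {R : realType}.

(** [G] contracts [Q], so some iterate contracts the norm. The fixed point of the iterate is unique,
    and [G] maps it to another one, hence fixes it. *)
Lemma equivalent_norm_fixed_point {X : completeNormedModType R} (Q : X -> R)
    (G : X -> X) (c q : R) :
  (forall x, `|x| ^+ 2 <= Q x) -> (forall x, Q x <= c * `|x| ^+ 2) ->
  0 <= q < 1 -> (forall x y, Q (G x - G y) <= q * Q (x - y)) ->
  exists x, x = G x.
Proof.
move=> leQ Qle /andP[q0 q1] QG.
have Qiter n x y : Q (iter n G x - iter n G y) <= q ^+ n * Q (x - y).
  elim: n => [|n IH]; first by rewrite expr0 mul1r.
  by rewrite exprS -mulrA; apply: le_trans (QG _ _) _; rewrite ler_wpM2l.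
(* The target 1/4 is the square of the contraction factor 1/2. *)
have [n qn] : exists n, q ^+ n * `|c| <= 4^-1.
  have cv : (fun n => q ^+ n * `|c|) @ \oo --> 0 * `|c|.
    by apply: cvgMl; apply: cvg_expr; rewrite ger0_norm.
  have /cvgrPdist_le/(_ 4^-1)[|n _ /(_ n (leqnn n))] := cv; first by lra.
  by rewrite /= mul0r sub0r normrN ger0_norm ?mulr_ge0 ?exprn_ge0//; exists n.
have half0 : 0 <= 2^-1 :> R by [].
have ctr : is_contraction (totalfun (iter n G)).
  exists (NngNum half0); split => /=; first by lra.
  move=> [x y] _ /=; rewrite -(ler_pXn2r (n := 2))// ?nnegrE ?mulr_ge0//.
  apply: le_trans (leQ _) _; apply: le_trans (Qiter _ _ _) _.
  apply: le_trans (ler_wpM2l (exprn_ge0 _ q0) (Qle _)) _.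
  rewrite exprMn mulrA ler_wpM2r ?exprn_ge0//.
  have : q ^+ n * c <= q ^+ n * `|c| by rewrite ler_wpM2l ?exprn_ge0// ler_norm.
  by lra.
have [|x _ /= fx] := banach_fixed_point ctr closedT; first by exists 0.
exists x; apply: (contraction_fixpoint_unique ctr) => //=.
by change (G x = iter n G (G x)); rewrite -iterSr iterS -[iter n G x]fx.
Qed.

End FixedPoint.

Section Hammerstein.
Context {R : realType} {H1 H2 H3 W : hilbertType R}.
Variables (T1 : {linear H1 -> W}) (T2 : {linear H2 -> W}) (T3 : {linear H3 -> W}).
Variables (S1 : {linear W -> H1}) (S2 : {linear W -> H2}) (S3 : {linear W -> H3}).
Hypotheses (adj1 : forall x w, '<T1 x, w> = '<x, S1 w>)
  (adj2 : forall x w, '<T2 x, w> = '<x, S2 w>)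
  (adj3 : forall x w, '<T3 x, w> = '<x, S3 w>).

Let X := (H1 * H2 * H3)%type.
Let T (x : X) : W := T1 x.1.1 + T2 x.1.2 + T3 x.2.
(** The squared Hilbert norm; the norm of the product itself is the maximum of the component
    norms. *)
Let Q (x : X) : R := `|x.1.1| ^+ 2 + `|x.1.2| ^+ 2 + `|x.2| ^+ 2.

Lemma sqr_norm_relaxation {H : hilbertType R} (t : R) (x y : H) :
  `|x - t *: (x + y)| ^+ 2 =
  (1 - t) ^+ 2 * `|x| ^+ 2 - 2 * t * (1 - t) * '<x, y> + t ^+ 2 * `|y| ^+ 2.
Proof. by rewrite !sqr_norm_inner !innerE (innerC y x); ring. Qed.

(* The relaxation step t = 1 / (1 + K) minimises the squared contraction factor
   (1 - t)^2 + K t^2, where K bounds the squared Lipschitz constant of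
   x |-> S (F (T x)) in the Hilbert norm sqrt Q. *)
Lemma hammerstein_solution (F : W -> W) (f : W) (c L : R) :
  (forall w, `|S1 w| <= c * `|w|) -> (forall w, `|S2 w| <= c * `|w|) ->
  (forall w, `|S3 w| <= c * `|w|) ->
  (forall x y, 0 <= '<F (T x) - F (T y), T x - T y>) ->
  0 <= L -> (forall x y, `|F (T x) - F (T y)| ^+ 2 <= L * Q (x - y)) ->
  exists x : X, [/\ x.1.1 = S1 (f - F (T x)), x.1.2 = S2 (f - F (T x)) &
    x.2 = S3 (f - F (T x))].
Proof.
move=> S1c S2c S3c monoF L0 lipF.
(* Each of the three terms |S_i w|^2 is at most c^2 |w|^2, and |w|^2 is at most [L] times [Q]. *)
pose K := 3 * c ^+ 2 * L.
have K0 : 0 <= K by rewrite mulr_ge0// mulr_ge0// sqr_ge0.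
pose t := (1 + K)^-1.
have K1 : 1 + K != 0 by rewrite gt_eqF// ltr_pwDl.
have t0 : 0 < t by rewrite invr_gt0 ltr_pwDl.
have t1 : t <= 1 by rewrite invf_le1 ?ltr_pwDl// lerDl.
pose G (x : X) : X :=
  (x.1.1 - t *: (x.1.1 - S1 (f - F (T x))), x.1.2 - t *: (x.1.2 - S2 (f - F (T x))),
   x.2 - t *: (x.2 - S3 (f - F (T x)))).
have Gdiff (H : hilbertType R) (S : {linear W -> H}) (a b : H) (x y : X) :
    (a - t *: (a - S (f - F (T x)))) - (b - t *: (b - S (f - F (T y)))) =
    (a - b) - t *: ((a - b) + S (F (T x) - F (T y))).
  have -> : S (F (T x) - F (T y)) = S (f - F (T y)) - S (f - F (T x)).
    by rewrite -linearB opprB [f - _ + _]addrC addrA subrK.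
  rewrite opprD addrACA -opprD -scalerBr opprB.
  congr (_ - _ *: _); rewrite addrACA [RHS]addrACA; congr (_ + _); exact: addrC.
have sqrS (H : hilbertType R) (S : {linear W -> H}) w :
    (forall w, `|S w| <= c * `|w|) -> `|S w| ^+ 2 <= c ^+ 2 * `|w| ^+ 2.
  move=> Sc; rewrite -exprMn lerXn2r ?nnegrE//.
  exact: le_trans (Sc w).
have [|||x y|x xG] := @equivalent_norm_fixed_point _ X Q G 3 (K * t).
- move=> x; rewrite /Q prod_normE.
  have := sqr_ge0 `|x.1.1|; have := sqr_ge0 `|x.1.2|.
  have := sqr_ge0 `|x.2|.
  have [_|_] := leP `|x.1| `|x.2|; first by lra.
  by rewrite prod_normE; have [_|_] := leP `|x.1.1| `|x.1.2|; lra.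
- move=> x; rewrite /Q.
  have le_x (a : R) : 0 <= a -> a <= `|x| -> a ^+ 2 <= `|x| ^+ 2.
    by move=> a0 ax; rewrite lerXn2r// nnegrE (le_trans a0).
  have h1 : `|x.1.1| ^+ 2 <= `|x| ^+ 2.
    by apply: le_x => //; rewrite prod_normE /= prod_normE /= !le_max lexx.
  have h2 : `|x.1.2| ^+ 2 <= `|x| ^+ 2.
    by apply: le_x => //; rewrite prod_normE /= prod_normE /= !le_max lexx orbT.
  have h3 : `|x.2| ^+ 2 <= `|x| ^+ 2.
    by apply: le_x => //; rewrite prod_normE /= !le_max lexx orbT.
  by lra.
- by rewrite mulr_ge0 ?(ltW t0)//= ltr_pdivrMr ?mul1r ?ltr_pwDl//.
- set w := F (T x) - F (T y).
  have monow : 0 <= '<x.1.1 - y.1.1, S1 w> + '<x.1.2 - y.1.2, S2 w> + '<x.2 - y.2, S3 w>.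
    rewrite -adj1 -adj2 -adj3 -!innerDl innerC (linearB T1) (linearB T2) (linearB T3).
    have -> : T1 x.1.1 - T1 y.1.1 + (T2 x.1.2 - T2 y.1.2) + (T3 x.2 - T3 y.2) =
      T x - T y by rewrite /T opprD [RHS]addrACA opprD [X in _ = X + _]addrACA.
    exact: monoF.
  have := lipF x y; rewrite -/w /Q.
  have := sqrS _ _ w S1c; have := sqrS _ _ w S2c; have := sqrS _ _ w S3c.
  rewrite /G /= !Gdiff -/w !sqr_norm_relaxation.
  move: monow.
  move: (`|S1 w| ^+ 2) (`|S2 w| ^+ 2) (`|S3 w| ^+ 2) (`|w| ^+ 2)
    '<x.1.1 - y.1.1, S1 w> '<x.1.2 - y.1.2, S2 w> '<x.2 - y.2, S3 w>
    (`|x.1.1 - y.1.1| ^+ 2) (`|x.1.2 - y.1.2| ^+ 2) (`|x.2 - y.2| ^+ 2).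
  move=> a1 a2 a3 n i1 i2 i3 d1 d2 d3 mono h1 h2 h3 hn.
  have ht : 0 <= 2 * t * (1 - t) * (i1 + i2 + i3).
    by apply: mulr_ge0 => //; apply: mulr_ge0; rewrite ?subr_ge0// mulr_ge0// ltW.
  have hK : a1 + a2 + a3 <= K * (d1 + d2 + d3).
    apply: (@le_trans _ _ (3 * c ^+ 2 * n)); first by lra.
    by have := ler_wpM2l (sqr_ge0 c) hn; rewrite /K; lra.
  have hK' := ler_wpM2l (sqr_ge0 t) hK.
  (* The choice of [t] gives 1 - t = K t. *)
  have tE : (1 - t) ^+ 2 + t ^+ 2 * K = K * t by rewrite /t; field.
  have -> : K * t * (d1 + d2 + d3) =
    (1 - t) ^+ 2 * (d1 + d2 + d3) + t ^+ 2 * (K * (d1 + d2 + d3)).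
    by rewrite mulrA -mulrDl tE.
  by lra.
- have fix_eq (H : hilbertType R) (a b : H) : a = a - t *: (a - b) -> a = b.
    move=> /eqP; rewrite -subr_eq0 opprB addrC subrK scaler_eq0 gt_eqF//=.
    by rewrite subr_eq0 => /eqP.
  exists x; split; apply: fix_eq; [exact: (congr1 (fun z : X => z.1.1) xG)
    |exact: (congr1 (fun z : X => z.1.2) xG)|exact: (congr1 snd xG)].
Qed.

End Hammerstein.

(** * Hilbert complexes *)

Section HilbertComplexTheory.
Context {R : realType} (W : hilbertComplex R).

Lemma subspace_dom i : subspace_set (hc_dom W i).
Proof. by split; [exact: hc_dom0|exact: hc_domP]. Qed.

(** The two vectors live in degrees that are equal but not convertible, so only their norms are
    compared. *)
Lemma norm_hc_d i j (ij : i + 1 = j) (x : W i) : `|hc_d ij x| = `|d x|.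
Proof. by case: _ / ij. Qed.

Lemma sqr_normV j (u : W j) : normV u ^+ 2 = `|u| ^+ 2 + `|d u| ^+ 2.
Proof.
by rewrite /normV sqr_sqrtr /innerV -!sqr_norm_inner// addr_ge0 ?sqr_ge0.
Qed.

Lemma normV_ge0 j (u : W j) : 0 <= normV u.
Proof. exact: sqrtr_ge0. Qed.

Lemma norm_le_normV j (u : W j) : `|u| <= normV u.
Proof.
rewrite -(ler_pXn2r (n := 2))// ?nnegrE ?normV_ge0// sqr_normV lerDl.
exact: sqr_ge0.
Qed.

Lemma normV_le j (u : W j) : normV u <= `|u| + `|d u|.
Proof.
rewrite -(ler_pXn2r (n := 2))// ?nnegrE ?normV_ge0 ?addr_ge0//.
rewrite sqr_normV sqrrD addrAC lerDl mulrn_wge0// mulr_ge0//.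
Qed.


Variable k : int.

Lemma dB (x y : W k) : hc_dom W k x -> hc_dom W k y -> d (x - y) = d x - d y.
Proof. exact: (operatorB (hc_dP (erefl (k + 1)))). Qed.

Lemma dD (x y : W k) : hc_dom W k x -> hc_dom W k y -> d (x + y) = d x + d y.
Proof. by move=> Dx Dy; have := hc_dP (erefl (k + 1)) 1 Dx Dy; rewrite !scale1r. Qed.

Lemma dprevB (x y : W (k - 1)) :
  hc_dom W (k - 1) x -> hc_dom W (k - 1) y -> dprev (x - y) = dprev x - dprev y.
Proof. exact: (operatorB (hc_dP (subrK 1 k))). Qed.

Lemma dprev_cocycle (x : W (k - 1)) : hc_dom W (k - 1) x -> cocycles (dprev x).
Proof. by move=> Dx; split; [exact: hc_d_dom|exact: hc_dd]. Qed.

Lemma cocyclesE_prev :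
  @cocycles _ W (k - 1) = [set x | hc_dom W (k - 1) x /\ hc_d (subrK 1 k) x = 0].
Proof.
apply/seteqP; split => x [Dx dx]; split => //; apply/eqP; rewrite -normr_eq0.
  by rewrite norm_hc_d dx normr0.
by rewrite -(norm_hc_d (subrK 1 k)) dx normr0.
Qed.

Lemma subspace_cocycles j : subspace_set (@cocycles _ W j).
Proof. exact: (subspace_kernel (subspace_dom j) (hc_dP (erefl (j + 1)))). Qed.

Lemma closed_cocycles j : closed (@cocycles _ W j).
Proof. exact: (closed_kernel (@hc_d_closed _ W _ _ (erefl (j + 1)))). Qed.

Lemma subspace_harmonic : subspace_set (@Defs.harmonic _ W k).
Proof.
split; first by split; [exact: (subspace_cocycles k).1|move=> y _; exact: inner0l].
move=> a x y [Zx Bx] [Zy By]; split; first exact: (subspace_cocycles k).2.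
by move=> z Bz; rewrite innerDl innerZl Bx// By// mulr0 addr0.
Qed.

Lemma closed_harmonic : closed (@Defs.harmonic _ W k).
Proof. by apply: closedI; [exact: closed_cocycles|exact: closed_orthogonal]. Qed.

Lemma coboundary_cocycle (x : W k) : coboundaries x -> cocycles x.
Proof. by move=> [y Dy <-]; exact: dprev_cocycle. Qed.

(** * Existence of a solution *)

Lemma mixed_solution_exists (F : W k -> W k) (f : W k) :
  closed_complex W -> monotone_op F -> (exists CF, lipschitz_constant F CF) ->
  exists sigma u p, mixed_solution F f sigma u p.
Proof.
move=> closedW monoF [CF lipF].
pose i1 := subrK 1 k; pose i2 := erefl (k + 1).
have [S1 [c1 [c10 S1c pinv1]]] := pseudo_inverse_exists (subspace_dom (k - 1))
  (hc_dP i1) (@hc_d_closed _ W _ _ i1) (closedW _ _ i1).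
have [S2 [c2 [c20 S2c pinv2]]] := pseudo_inverse_exists (subspace_dom k)
  (hc_dP i2) (@hc_d_closed _ W _ _ i2) (closedW _ _ i2).
have [T1 [T1c adj1]] := adjoint_exists c10 S1c.
have [T2 [T2c adj2]] := adjoint_exists c20 S2c.
have [P [HP PP]] := projection_linear subspace_harmonic closed_harmonic.
have T1B x : coboundaries (T1 x).
  exact: (adjoint_pseudo_inverse_range (subspace_dom (k - 1)) (hc_dP i1) (closedW _ _ i1)
    pinv1 adj1).
have [S1D S1Z S1A] := pinv1; have [S2D S2Z S2A] := pinv2.
pose c := c1 + 1 + c2.
have c0 : 0 <= c by rewrite /c; lra.
have weaken (V1 V2 : hilbertType R) (S : V1 -> V2) a : a <= c ->
    (forall w, `|S w| <= a * `|w|) -> forall w, `|S w| <= c * `|w|.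
  by move=> ac Sa w; apply: le_trans (Sa w) _; rewrite ler_wpM2r.
have Pc w : `|P w| <= 1 * `|w| by rewrite mul1r; exact: projection_le HP PP w.
have [c1c c2c c1_le] : [/\ c1 <= c, c2 <= c & 1 <= c] by rewrite /c; split; lra.
have S1c' := weaken _ _ _ _ c1c S1c; have T1c' := weaken _ _ _ _ c1c T1c.
have S2c' := weaken _ _ _ _ c2c S2c; have T2c' := weaken _ _ _ _ c2c T2c.
have Pc' := weaken _ _ _ _ c1_le Pc.
have dT1 x : cocycles (T1 x) by exact: coboundary_cocycle.
have dP x : cocycles (P x) := (HP x).1.
pose T (x : W (k - 1) * W k * W (k + 1)) := T1 x.1.1 + P x.1.2 + S2 x.2.
(* [T] takes values in the domain of d, where the hypotheses on [F] apply. *)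
have dT x : hc_dom W k (T x) /\ d (T x) = d (S2 x.2).
  have [D1 d1] := dT1 x.1.1; have [D2 d2] := dP x.1.2.
  have D12 : hc_dom W k (T1 x.1.1 + P x.1.2).
    by apply: subspace_setD => //; exact: subspace_dom.
  split; first by apply: subspace_setD => //; exact: subspace_dom.
  by rewrite /T dD// dD// d1 d2 !add0r.
have TB x y : T x - T y = T (x - y).
  rewrite /T (linearB T1) (linearB P) (linearB S2).
  by rewrite opprD addrACA opprD [X in X + _]addrACA.
(* d (S2 y) is the projection of y onto the range of d. *)
have dS2 y : `|d (S2 y)| <= `|y|.
  apply: sqr_le_norm => //; have := S2A y _ (S2D y).
  rewrite innerDl innerNl => /eqP; rewrite subr_eq0 -sqr_norm_inner => /eqP ->.
  exact: inner_le.
have monoT x y : 0 <= '<F (T x) - F (T y), T x - T y>.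
  by apply: monoF; have [] := dT x; have [] := dT y.
(* The term 3 c^2 accounts for |T z|^2 and the 1 for |d (T z)|^2, where z = x - y. *)
have lipT x y : `|F (T x) - F (T y)| ^+ 2 <= CF ^+ 2 * (3 * c ^+ 2 + 1) *
    (`|(x - y).1.1| ^+ 2 + `|(x - y).1.2| ^+ 2 + `|(x - y).2| ^+ 2).
  have := lipF _ _ (dT x).1 (dT y).1; rewrite TB; move: (x - y) => z lipz.
  have : `|F (T x) - F (T y)| ^+ 2 <= CF ^+ 2 * normV (T z) ^+ 2.
    by rewrite -exprMn lerXn2r ?nnegrE// (le_trans _ lipz).
  move=> /le_trans; apply; rewrite -mulrA ler_wpM2l ?sqr_ge0//.
  rewrite sqr_normV (dT z).2.
  have hd : `|d (S2 z.2)| ^+ 2 <= `|z.2| ^+ 2 by rewrite lerXn2r ?nnegrE//.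
  have h1 : `|T z| <= c * (`|z.1.1| + `|z.1.2| + `|z.2|).
    rewrite !mulrDr; apply: le_trans (ler_normD _ _) _; apply: lerD => //.
    by apply: le_trans (ler_normD _ _) _; exact: lerD.
  have h2 : `|T z| ^+ 2 <= c ^+ 2 * (`|z.1.1| + `|z.1.2| + `|z.2|) ^+ 2.
    by rewrite -exprMn lerXn2r ?nnegrE// mulr_ge0// !addr_ge0.
  have h3 : (`|z.1.1| + `|z.1.2| + `|z.2|) ^+ 2 <=
      3 * (`|z.1.1| ^+ 2 + `|z.1.2| ^+ 2 + `|z.2| ^+ 2).
    have := sqr_ge0 (`|z.1.1| - `|z.1.2|); have := sqr_ge0 (`|z.1.1| - `|z.2|).
    by have := sqr_ge0 (`|z.1.2| - `|z.2|); lra.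
  have h4 := ler_wpM2l (sqr_ge0 c) h3.
  have := sqr_ge0 `|z.1.1|; have := sqr_ge0 `|z.1.2|; lra.
have L0 : 0 <= CF ^+ 2 * (3 * c ^+ 2 + 1).
  by rewrite mulr_ge0 ?sqr_ge0// addr_ge0// mulr_ge0// sqr_ge0.
have adj1' x w : '<T1 x, w> = '<x, S1 w> by rewrite innerC -adj1 innerC.
(* The third pair enters reversed: [S2] is the operator and [T2] its adjoint. *)
have [[[sigma p] xi] /= [sigmaE pE xiE]] := hammerstein_solution adj1'
  (projection_inner HP PP) adj2 f S1c' Pc' T2c' monoT L0 lipT.
move: sigmaE pE xiE; set g := f - _ => sigmaE pE xiE.
have Pp : P p = p.
  by rewrite pE; exact: projection_id HP PP _ (HP g).
exists sigma, (T1 sigma + S2 xi), p.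
have uD : hc_dom W k (T1 sigma + S2 xi).
  by apply: subspace_setD; [exact: subspace_dom|exact: (dT1 _).1|exact: S2D].
have du : d (T1 sigma + S2 xi) = d (S2 xi).
  by have [D0 d0] := dT1 sigma; rewrite dD// d0 add0r.
split.
- by split => //; [rewrite sigmaE; exact: S1D|rewrite pE].
- move=> tau Dtau.
  rewrite innerDl (S2Z xi (dprev tau) (dprev_cocycle Dtau)) addr0 adj1'.
  have := S1Z g _ (pseudo_inverse_kernel (subspace_dom (k - 1)) (hc_dP i1) pinv1 Dtau).
  by rewrite -sigmaE innerDr innerNr.
- move=> v Dv.
  have -> : T1 sigma + S2 xi + p = T (sigma, p, xi) by rewrite /T /= Pp addrAC.
  rewrite du.
  have Zv := pseudo_inverse_kernel (subspace_dom k) (hc_dP i2) pinv2 Dv.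
  (* v splits into a cocycle [z] and S2 (d v), which is orthogonal to cocycles: dprev sigma and p
     see only [z], d u only the other part. *)
  have [z Zz zE] : exists2 z, cocycles z & z = v - S2 (d v) by exists (v - S2 (d v)).
  have vE : v = z + S2 (d v) by rewrite zE subrK.
  have dd_eq : '<d (S2 xi), d v> = '<g, S2 (d v)>.
    have := S2A xi _ Dv; rewrite innerDl innerNl => /eqP; rewrite subr_eq0 => /eqP ->.
    by rewrite xiE -[RHS]innerC adj2 innerC.
  have ds_z : '<dprev sigma, v> = '<dprev sigma, z>.
    rewrite {1}vE innerDr [X in _ + X]innerC S2Z ?addr0// sigmaE.
    exact: dprev_cocycle.
  have p_z : '<p, v> = '<p, z>.
    by rewrite {1}vE innerDr [X in _ + X]innerC S2Z ?addr0// pE; exact: dP.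
  suff : '<dprev sigma, z> + '<p, z> = '<g, z>.
    rewrite dd_eq ds_z p_z => h.
    have : '<g, v> = '<g, z> + '<g, S2 (d v)> by rewrite {1}vE innerDr.
    have : '<g, v> = '<f, v> - '<F (T (sigma, p, xi)), v> by rewrite innerDl innerNl.
    by move: h; lra.
  (* Hodge decomposition of [z]: dprev sigma reproduces g on the coboundary B z, p reproduces it on
     the harmonic remainder, and the mixed pairings vanish. *)
  have [B [BB BP]] := projection_linear
    (subspace_range (subspace_dom (k - 1)) (hc_dP i1)) (closedW _ _ i1).
  have Hz : Defs.harmonic (z - B z).
    split; last by move=> b Bb; exact: BP.
    by apply: subspace_setB => //; [exact: subspace_cocycles|exact: coboundary_cocycle (BB z)].
  have innerz a : '<a, z> = '<a, B z> + '<a, z - B z> by rewrite -innerDr addrC subrK.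
  have ds_B : '<dprev sigma, B z> = '<g, B z>.
    have [tau Dtau <-] := BB z; rewrite sigmaE.
    by have := S1A g _ Dtau; rewrite innerDl innerNl => /eqP; rewrite subr_eq0 => /eqP.
  have ds_h : '<dprev sigma, z - B z> = 0.
    by rewrite innerC Hz.2// sigmaE; exact: imageP.
  have p_B : '<p, B z> = 0 by rewrite pE ((HP g).2 _ (BB z)).
  have p_h : '<p, z - B z> = '<g, z - B z>.
    by have := PP g _ Hz; rewrite innerDl innerNl -pE => /eqP; rewrite subr_eq0 => /eqP.
  by rewrite !innerz ds_B ds_h p_B p_h addr0 add0r.
- by move=> q [Zq Bq]; rewrite innerDl (S2Z xi q Zq) addr0 innerC; exact: Bq.
Qed.

(** * Energy estimate for the difference of two solutions *)

Section Difference.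
Variables (F : W k -> W k) (f f' : W k) (s1 s2 : W (k - 1)) (u1 u2 p1 p2 : W k).
Hypotheses (monoF : monotone_op F)
  (sol1 : mixed_solution F f s1 u1 p1) (sol2 : mixed_solution F f' s2 u2 p2).

Let sigma := s1 - s2.
Let u := u1 - u2.
Let p := p1 - p2.
Let phi := F (u1 + p1) - F (u2 + p2).

Lemma difference_dom : [/\ hc_dom W (k - 1) sigma, hc_dom W k u & Defs.harmonic p].
Proof.
have [[Ds1 Du1 Hp1] _ _ _] := sol1; have [[Ds2 Du2 Hp2] _ _ _] := sol2.
by split; apply: subspace_setB => //; solve [exact: subspace_dom|exact: subspace_harmonic].
Qed.

Lemma difference_sigma tau : hc_dom W (k - 1) tau -> '<sigma, tau> = '<u, dprev tau>.
Proof.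
move=> Dtau; have [_ /(_ tau Dtau) e1 _ _] := sol1.
have [_ /(_ tau Dtau) e2 _ _] := sol2.
by rewrite /sigma /u !innerDl !innerNl; move: e1 e2; lra.
Qed.

Lemma difference_eq v : hc_dom W k v ->
  '<dprev sigma, v> + '<d u, d v> + '<p, v> + '<phi, v> = '<f - f', v>.
Proof.
move=> Dv; have [[Ds1 Du1 _] _ /(_ v Dv) e1 _] := sol1.
have [[Ds2 Du2 _] _ /(_ v Dv) e2 _] := sol2.
by rewrite /sigma /u dprevB// dB// !innerDl !innerNl; move: e1 e2; lra.
Qed.

Lemma difference_harmonic q : Defs.harmonic q -> '<u, q> = 0.
Proof.
move=> Hq; have [_ _ _ /(_ q Hq) e1] := sol1; have [_ _ _ /(_ q Hq) e2] := sol2.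
by rewrite innerDl innerNl e1 e2 subrr.
Qed.

(** The test function is u + p: the first equation turns <dprev sigma, u> into |sigma|^2, the cross
    terms with p vanish by orthogonality, and monotonicity discards the term in [phi]. *)
Lemma difference_energy :
  `|sigma| ^+ 2 + `|d u| ^+ 2 + `|p| ^+ 2 <= '<f - f', u + p>.
Proof.
have [Ds Du Hp] := difference_dom; have [[Dp dp] Bp] := Hp.
have Dup : hc_dom W k (u + p) by apply: subspace_setD => //; exact: subspace_dom.
have su : '<dprev sigma, u> = `|sigma| ^+ 2.
  by rewrite innerC -difference_sigma// sqr_norm_inner.
have sp : '<dprev sigma, p> = 0 by rewrite innerC Bp//; exact: imageP.
have pu : '<p, u> = 0 by rewrite innerC difference_harmonic.
have := difference_eq Dup.
rewrite dD// dp addr0 3!innerDr su sp pu -!sqr_norm_inner => <-.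
suff : 0 <= '<phi, u + p> by lra.
have [[_ Du1 [[Dp1 _] _]] _ _ _] := sol1; have [[_ Du2 [[Dp2 _] _]] _ _ _] := sol2.
rewrite /u /p addrACA -opprD; apply: monoF.
  by apply: subspace_setD => //; exact: subspace_dom.
by apply: subspace_setD => //; exact: subspace_dom.
Qed.

End Difference.

(** v - B v is harmonic, hence orthogonal to v by assumption and to the coboundary B v, so it is
    zero. *)
Lemma cocycle_coboundary (v : W k) : closed_complex W -> cocycles v ->
  (forall q, Defs.harmonic q -> '<v, q> = 0) -> coboundaries v.
Proof.
move=> closedW Zv Hv; pose i1 := subrK 1 k.
have [B [BB BP]] := projection_linear
  (subspace_range (subspace_dom (k - 1)) (hc_dP i1)) (closedW _ _ i1).
have Hq : Defs.harmonic (v - B v).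
  split; last by move=> b Bb; exact: BP.
  by apply: subspace_setB => //; [exact: subspace_cocycles|exact: coboundary_cocycle (BB v)].
suff -> : v = B v by exact: BB.
apply/subr0_eq/inner_eq0.
by rewrite {1}innerDl innerNl Hv// innerC Hq.2 ?subrr//; exact: BB.
Qed.

Lemma mixed_solution_unique (F : W k -> W k) f s1 s2 u1 u2 p1 p2 :
  closed_complex W -> monotone_op F ->
  mixed_solution F f s1 u1 p1 -> mixed_solution F f s2 u2 p2 ->
  [/\ s1 = s2, u1 = u2 & p1 = p2].
Proof.
move=> closedW monoF sol1 sol2.
have := difference_energy monoF sol1 sol2; rewrite subrr inner0l => energy.
have [Ds Du Hp] := difference_dom sol1 sol2.
have h1 := sqr_ge0 `|s1 - s2|; have h2 := sqr_ge0 `|d (u1 - u2)|.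
have h3 := sqr_ge0 `|p1 - p2|.
have zero (V : normedModType R) (x : V) : `|x| ^+ 2 = 0 -> x = 0.
  by move=> /eqP; rewrite sqrf_eq0 normr_eq0 => /eqP.
have s0 : s1 - s2 = 0 by apply: zero; lra.
have du0 : d (u1 - u2) = 0 by apply: zero; lra.
have p0 : p1 - p2 = 0 by apply: zero; lra.
split; [exact: subr0_eq|apply: subr0_eq|exact: subr0_eq].
(* u1 - u2 equals dprev t, so its squared norm is <s1 - s2, t> = 0. *)
have [t Dt tE] := cocycle_coboundary closedW (conj Du du0) (difference_harmonic sol1 sol2).
apply: inner_eq0; rewrite -{2}tE; have := difference_sigma sol1 sol2 Dt.
by rewrite s0 inner0l.
Qed.

Lemma poincare_norm j (cP : R) (v : W j) : poincare_constant W j cP ->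
  hc_dom W j v -> orthogonal_to (@cocycles _ W j) v -> `|v| <= `|cP| * `|d v|.
Proof.
move=> PcP Dv Zv; apply: le_trans (norm_le_normV v) _.
by apply: le_trans (PcP v Dv Zv) _; rewrite ler_wpM2r// ler_norm.
Qed.

(* Splitting u = b + z with b a coboundary and z orthogonal to the cocycles,
   z is controlled by d u, and b by sigma, because sigma is the codifferential
   of u. *)
Lemma mixed_norm_le (cP : R) (sigma : W (k - 1)) (u : W k) :
  closed_complex W -> poincare_constant W (k - 1) cP -> poincare_constant W k cP ->
  hc_dom W k u ->
  (forall tau, hc_dom W (k - 1) tau -> '<sigma, tau> = '<u, dprev tau>) ->
  (forall q, Defs.harmonic q -> '<u, q> = 0) ->
  `|u| <= `|cP| * `|sigma| + `|cP| * `|d u|.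
Proof.
move=> closedW P1 P2 Du us uH.
have [Z [ZZ ZP]] := projection_linear (subspace_cocycles k) (@closed_cocycles k).
have [Y [YZ YP]] := projection_linear (subspace_cocycles (k - 1)) (@closed_cocycles (k - 1)).
have [DZ dZ] := ZZ u.
have uZ : `|u - Z u| <= `|cP| * `|d u|.
  have -> : d u = d (u - Z u) by rewrite dB// dZ subr0.
  apply: poincare_norm => //; first by apply: subspace_setB => //; exact: subspace_dom.
  by move=> z Zz; exact: ZP.
have [t Dt tE] : coboundaries (Z u).
  apply: cocycle_coboundary => // q Hq; have := ZP u q Hq.1.
  by rewrite innerDl innerNl uH//; lra.
have [DY dY] := YZ t.
(* Removing the cocycle part of [t] keeps its image and makes the Poincare inequality in degree k -
   1 applicable. *)
have DtY : hc_dom W (k - 1) (t - Y t) by apply: subspace_setB => //; exact: subspace_dom.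
have dYt : dprev (t - Y t) = Z u.
  rewrite dprevB// -tE; have := YZ t; rewrite cocyclesE_prev => -[_].
  by rewrite /dprev => ->; rewrite subr0.
have tY : `|t - Y t| <= `|cP| * `|Z u|.
  rewrite -dYt /dprev norm_hc_d; apply: poincare_norm => // z Zz; exact: YP.
(* |Z u|^2 = <u, dprev (t - Y t)> = <sigma, t - Y t>. *)
have : `|Z u| <= `|cP| * `|sigma|.
  apply: sqr_le_norm; first exact: mulr_ge0.
  have -> : `|Z u| ^+ 2 = '<u, Z u>.
    have := ZP u _ (ZZ u); rewrite innerDl innerNl sqr_norm_inner; lra.
  rewrite -{1}dYt -us//; apply: le_trans (inner_le _ _) _.
  by have := ler_wpM2l (normr_ge0 sigma) tY; lra.
move=> ZU; have := ler_normD (Z u) (u - Z u); rewrite addrC subrK; lra.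
Qed.

End HilbertComplexTheory.

(** * Stability *)

(** For differences, let E^2 = |sigma|^2 + |d u|^2 + |p|^2 and g = f - f'. Then |u + p| <= K E and E
    <= K |g|. The leading 1 is the term |g| in the bound on dprev sigma, 2 counts |sigma| and |p|,
    the next K bounds the V-norm of u, and the last summand is the Lipschitz bound. *)
Definition stability_constant {R : realType} (cP CF : R) : R :=
  let K := 2 * `|cP| + 1 in 1 + (2 + K + `|CF| * (K + 1)) * K.

Lemma mixed_solution_stable {R : realType} (W : hilbertComplex R) (k : int)
    (F : W k -> W k) (cP CF : R) (f f' : W k) (s1 s2 : W (k - 1)) (u1 u2 p1 p2 : W k) :
  closed_complex W -> monotone_op F ->
  poincare_constant W (k - 1) cP -> poincare_constant W k cP ->
  lipschitz_constant F CF ->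
  mixed_solution F f s1 u1 p1 -> mixed_solution F f' s2 u2 p2 ->
  normV (s1 - s2) + normV (u1 - u2) + `|p1 - p2|
    <= stability_constant cP CF * `|f - f'|.
Proof.
move=> closedW monoF P1 P2 lipF sol1 sol2.
have energy := difference_energy monoF sol1 sol2.
have [Ds Du Hp] := difference_dom sol1 sol2.
have sigmaE := difference_sigma sol1 sol2.
have uH := difference_harmonic sol1 sol2.
have eqv := difference_eq sol1 sol2.
have lip : `|F (u1 + p1) - F (u2 + p2)| <= `|CF| * normV ((u1 - u2) + (p1 - p2)).
  have [[_ Du1 [[Dp1 _] _]] _ _ _] := sol1; have [[_ Du2 [[Dp2 _] _]] _ _ _] := sol2.
  rewrite addrACA -opprD; apply: le_trans (lipF _ _ _ _) _.
  - by apply: subspace_setD => //; exact: subspace_dom.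
  - by apply: subspace_setD => //; exact: subspace_dom.
  - by rewrite ler_wpM2r ?normV_ge0// ler_norm.
have ule := mixed_norm_le closedW P1 P2 Du sigmaE uH.
move: (s1 - s2) (u1 - u2) (p1 - p2) (F (u1 + p1) - F (u2 + p2)) (f - f')
  energy Ds Du Hp sigmaE uH eqv lip ule => sigma u p phi g.
move=> energy Ds Du [[Dp dp] Bp] sigmaE uH eqv lip ule.
set a := `|cP| in ule *; have a0 : 0 <= a by exact: normr_ge0.
pose K := 2 * a + 1.
pose E := Num.sqrt (`|sigma| ^+ 2 + `|d u| ^+ 2 + `|p| ^+ 2).
have S0 : 0 <= `|sigma| ^+ 2 + `|d u| ^+ 2 + `|p| ^+ 2.
  by rewrite !addr_ge0// sqr_ge0.
have E0 : 0 <= E by exact: sqrtr_ge0.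
have E2 : E ^+ 2 = `|sigma| ^+ 2 + `|d u| ^+ 2 + `|p| ^+ 2 by exact: sqr_sqrtr.
have leE x : 0 <= x -> x ^+ 2 <= E ^+ 2 -> x <= E.
  by move=> x0; rewrite ler_pXn2r// nnegrE.
have := sqr_ge0 `|sigma|; have := sqr_ge0 `|d u|; have := sqr_ge0 `|p| => q1 q2 q3.
have sE : `|sigma| <= E by apply: leE => //; rewrite E2; lra.
have dE : `|d u| <= E by apply: leE => //; rewrite E2; lra.
have pE : `|p| <= E by apply: leE => //; rewrite E2; lra.
have uE : `|u| <= 2 * a * E.
  by have := ler_wpM2l a0 sE; have := ler_wpM2l a0 dE; lra.
have upE : `|u + p| <= K * E by have := ler_normD u p; rewrite /K; lra.
(* The energy estimate gives E^2 <= |g| |u + p| <= K |g| E; one factor E is cancelled. *)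
have Eg : E <= K * `|g|.
  have [E_eq0|Epos] := eqVneq E 0; first by rewrite E_eq0 mulr_ge0// /K; lra.
  have Egt0 : 0 < E by rewrite lt_neqAle eq_sym Epos.
  rewrite -(ler_pM2r Egt0) -expr2 E2; apply: le_trans energy _.
  apply: le_trans (inner_le _ _) _.
  by have := ler_wpM2l (normr_ge0 g) upE; lra.
have Vup : normV (u + p) <= (K + 1) * E.
  by apply: le_trans (normV_le _) _; rewrite dD// dp addr0; lra.
have phiE : `|phi| <= `|CF| * ((K + 1) * E).
  by apply: le_trans lip _; rewrite ler_wpM2l.
(* Testing with dprev sigma removes the d u term, since d d = 0, and the p term, since p is
   orthogonal to coboundaries. *)
have dsE : `|dprev sigma| <= `|g| + `|phi|.
  apply: sqr_le_norm; first exact: addr_ge0.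
  have [Dds dds] := dprev_cocycle Ds.
  have := eqv _ Dds; rewrite dds inner0r addr0 Bp; last exact: imageP.
  rewrite addr0 -sqr_norm_inner => dsq.
  have := inner_le g (dprev sigma); have := norm_inner_le phi (dprev sigma).
  by rewrite ler_norml => /andP[+ _]; rewrite mulrDl; lra.
have Vs : normV sigma <= `|sigma| + `|dprev sigma|.
  by rewrite /dprev norm_hc_d; exact: normV_le.
have Vu := normV_le u.
have tot : normV sigma + normV u + `|p| <= `|g| + (2 + K + `|CF| * (K + 1)) * E.
  by move: Vs Vu dsE phiE uE sE dE pE; rewrite /K; lra.
have -> : stability_constant cP CF = 1 + (2 + K + `|CF| * (K + 1)) * K by [].
have K0 : 0 <= K by rewrite /K; lra.
apply: le_trans tot _; rewrite [leRHS]mulrDl mul1r lerD2l -mulrA.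
have CK0 : 0 <= `|CF| * (K + 1) by apply: mulr_ge0 => //; lra.
by apply: ler_wpM2l => //; lra.
Qed.

Theorem theorem3p4 (R : realType) :
  exists C : R -> R -> R,
  forall (W : hilbertComplex R) (k : int) (F : W k -> W k),
    closed_complex W ->
    monotone_op F ->
    (exists CF : R, lipschitz_constant F CF) ->
    (forall f : W k,
       exists! s : W (k - 1) * W k * W k, mixed_solution F f s.1.1 s.1.2 s.2) /\
    (forall cP CF : R,
       poincare_constant W (k - 1) cP ->
       poincare_constant W k cP ->
       lipschitz_constant F CF ->
       forall (f f' : W k) (sigma sigma' : W (k - 1)) (u u' p p' : W k),
         mixed_solution F f sigma u p ->
         mixed_solution F f' sigma' u' p' ->
         normV (sigma - sigma') + normV (u - u') + `|p - p'|
           <= C cP CF * `|f - f'|).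
Proof.
exists stability_constant => W k F closedW monoF lipF; split=> [f|cP CF P1 P2 lip].
  have [sigma [u [p sol]]] := mixed_solution_exists f closedW monoF lipF.
  exists (sigma, u, p); split=> // -[[sigma' u'] p'] /= sol'.
  by have [-> -> ->] := mixed_solution_unique closedW monoF sol sol'.
by move=> f f' sigma sigma' u u' p p'; exact: mixed_solution_stable.
Qed.
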